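(* Let $(\Pi,\Sigma)$ be a Coxeter system and let ${\mathcal{Q}},{\mathcal{S}}$ be words in the alphabet $\Sigma$ with $\widetilde\delta({\mathcal{S}})={\mathcal{S}}$. Then the slide complex $\widetilde\Delta({\mathcal{Q}},{\mathcal{S}})$ is homeomorphic to a sphere if $\widetilde\delta({\mathcal{Q}})={\mathcal{S}}$, and to a ball otherwise. A face ${\mathcal{Q}}\setminus{\mathcal{P}}$ belongs to the boundary of this complex if and only if $\widetilde\delta({\mathcal{P}})\neq{\mathcal{S}}$.
   Context: A word is a finite sequence of elements of $\Sigma$; a subword of ${\mathcal{Q}}=(\sigma_1,\dots,\sigma_m)$ is a subsequence (a set of positions). The slide complex $\widetilde\Delta({\mathcal{Q}},{\mathcal{S}})$ is the simplicial complex on the positions of ${\mathcal{Q}}$ whose faces are the subwords ${\mathcal{Q}}\setminus{\mathcal{P}}$ whose complements ${\mathcal{P}}$ contain ${\mathcal{S}}$ as a subword (as a sequence of letters), ordered by inclusion. For a word ${\mathcal{Q}}$, $\widetilde\delta({\mathcal{Q}})$ denotes the word obtained from ${\mathcal{Q}}$ by replacing each maximal block of consecutive identical letters $s_i\cdots s_i$ by a single letter $s_i$ (e.g. $\widetilde\delta(s_1s_1s_2s_1s_2s_2s_2)=s_1s_2s_1s_2$).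
   Formalization: The ball clause additionally assumes that S is a subword of Q; otherwise the slide complex has no faces at all (e.g. Q empty, S a single letter), and its empty realization is not a ball. *)

(* Defs.v *)
From HB Require Import structures.
From mathcomp Require Import all_boot all_order all_algebra.
From mathcomp Require Import all_classical all_reals all_analysis.
Set Implicit Arguments.
Unset Strict Implicit.
Unset Printing Implicit Defensive.
Import Order.TTheory GRing.Theory Num.Theory.
Import numFieldNormedType.Exports.

Section CoxeterSystem.
Local Open Scope group_scope.

(* (G, Sigma) is a Coxeter system: Sigma consists of involutions, generates G
   (products of letters suffice, since letters are their own inverses), and the
   relations (s * t)^m(s, t) = 1, with m(s, t) the order of s * t whenever that
   order is finite, present G.  As (s * t)^n = 1 iff m(s, t) divides n, the
   relations hold for a family (f s) iff every n with (s * t)^n = 1 satisfies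
   (f s * f t)^n = 1; the presentation is expressed by its universal
   property.  Only the values of f on Sigma matter.  Neither G nor Sigma is
   assumed to be finite. *)
Definition coxeter_system (G : groupType) (Sigma : {pred G}) : Prop :=
  [/\ forall s, s \in Sigma -> s <> 1 /\ s * s = 1,
      forall g : G, exists2 w : seq G,
        {subset w <= Sigma} & g = foldr (fun x y => x * y) 1 w
    & forall (H : groupType) (f : G -> H),
        (forall s t, s \in Sigma -> t \in Sigma ->
           forall n : nat, (s * t) ^+ n = 1 -> (f s * f t) ^+ n = 1) ->
        exists phi : G -> H, {morph phi : x y / x * y}
          /\ {in Sigma, phi =1 f}].

End CoxeterSystem.

Section SlideComplex.
Local Open Scope nat_scope.

Fixpoint delta (T : eqType) (w : seq T) : seq T :=
  if w is x :: w' then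
    if w' is y :: _ then if x == y then delta w' else x :: delta w'
    else [:: x]
  else [::].

(* enum lists the positions of P in increasing order *)
Definition word_at (T : eqType) (Q : seq T) (P : {set 'I_(size Q)}) : seq T :=
  [seq tnth (in_tuple Q) i | i <- enum P].

Definition slide_complex (T : eqType) (Q S : seq T) :
    {set {set 'I_(size Q)}} :=
  [set F : {set 'I_(size Q)} | subseq S (word_at (~: F))]%SET.

Variable m : nat.
Implicit Types (K : {set {set 'I_m}}) (F G H : {set 'I_m}).

Definition facets_containing K F : {set {set 'I_m}} :=
  [set H : {set 'I_m} | maxset (fun A => A \in K) H && (F \subset H)]%SET.

(* the codimension one faces that lie in exactly one facet *)
Definition boundary_ridge K G : bool :=
  (G \in K) &&
  [exists H : {set 'I_m},
     (facets_containing K G == [set H]%SET) && (#|H| == #|G|.+1)].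

Definition boundary_complex K : {set {set 'I_m}} :=
  [set F : {set 'I_m} | (F \in K) &&
     [exists G : {set 'I_m}, boundary_ridge K G && (F \subset G)]]%SET.

End SlideComplex.

Section Topology.
Local Open Scope classical_set_scope.
Local Open Scope ring_scope.
Variable R : realType.

(* Points of the realization are given by barycentric coordinates; the
   realization of the complex whose only face is empty is the empty set. *)
Definition realization (m : nat) (K : {set {set 'I_m}}) : set 'rV[R]_m :=
  [set x : 'rV[R]_m | [/\ forall i, 0 <= x 0 i, \sum_i x 0 i = 1
                        & [set i | x 0 i != 0]%SET \in K]].

Definition sqnorm (n : nat) (x : 'rV[R]_n) : R := \sum_i x 0 i ^+ 2.

(* The sphere of R^n has dimension n - 1; it is empty for n = 0. *)
Definition unit_sphere (n : nat) : set 'rV[R]_n := [set x | sqnorm x = 1].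
Definition unit_ball (n : nat) : set 'rV[R]_n := [set x | sqnorm x <= 1].

Definition homeomorphism (T U : topologicalType) (A : set T) (B : set U)
    (f : T -> U) : Prop :=
  exists g : U -> T,
    [/\ {within A, continuous f}, {within B, continuous g},
        forall x, A x -> B (f x) /\ g (f x) = x
      & forall y, B y -> A (g y) /\ f (g y) = y].

Definition sphere_complex (m : nat) (K : {set {set 'I_m}}) : Prop :=
  exists (n : nat) (f : 'rV[R]_m -> 'rV[R]_n),
    homeomorphism (realization K) (@unit_sphere n) f.

(* The homeomorphism is asked to carry the realization of the boundary complex
   onto the bounding sphere, so that the combinatorial boundary of K is its
   boundary as a topological ball. *)
Definition ball_complex (m : nat) (K : {set {set 'I_m}}) : Prop :=
  exists (n : nat) (f : 'rV[R]_m -> 'rV[R]_n),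
    homeomorphism (realization K) (@unit_ball n) f
    /\ f @` realization (boundary_complex K) = @unit_sphere n.

End Topology.

Arguments sphere_complex R {m} K.
Arguments ball_complex R {m} K.

(* Main.v *)
Require Import Defs.
From mathcomp Require Import all_boot all_order all_algebra.
From mathcomp Require Import all_classical all_reals all_analysis.
From mathcomp Require Import lra.
Set Implicit Arguments.
Unset Strict Implicit.
Unset Printing Implicit Defensive.
Import Order.TTheory GRing.Theory Num.Theory.
Import numFieldNormedType.Exports.

(* Instead of the realization K(Q, S) one studies the cone C(Q, S) over it: the
   nonnegative vectors x indexed by the positions of Q such that S is a subword
   of the word w(x) at the zero coordinates of x.  By induction on Q, C(Q, S) is
   homeomorphic, by a positively homogeneous map, to some R^n if delta Q = S and
   otherwise to a half space R^n x [0, +oo[, the height being 0 exactly where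
   delta w(x) <> S; normalizing gives the sphere, resp. the ball as a hemisphere.

   Write Q = c Q'.  If S does not start with c, then C(Q, S) is C(Q', S) times a
   ray.  If S = c S', then C(Q, S) is C(Q', S') with C(Q', S) x [0, +oo[ attached
   along C(Q', S) x {0}, and C(Q', S) lies in the boundary of C(Q', S').  When it
   is the whole boundary, two half spaces are glued into a space.  Otherwise it
   is a half space D whose height h_D, extended by 0, is continuous on the
   boundary R^n of C(Q', S').  Shearing D x [0, +oo[ onto the region below D
   where -h_D <= height <= 0 turns C(Q, S) into {(y, t) | t >= -h_D(y)}, which a
   vertical shift maps onto the half space: however D is embedded, no Schoenflies
   theorem is needed. *)

(** * Words without equal neighbours and the collapse [delta] *)

Section Words.
Local Open Scope nat_scope.
Variable T : eqType.
Implicit Types (x y : T) (u v w S : seq T).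

(** Testing the head of [w] through [ohead] merges the branches of the recursion, so later
    inductions need not destruct the tail. *)
Lemma delta_cons x w :
  delta (x :: w) = if ohead w == Some x then delta w else x :: delta w.
Proof. by case: w => //= y w; rewrite (inj_eq Some_inj) eq_sym. Qed.

Lemma ohead_delta w : ohead (delta w) = ohead w.
Proof.
by elim: w => // x w IH; rewrite delta_cons; case: eqP => // E; rewrite IH.
Qed.

Lemma size_delta w : size (delta w) <= size w.
Proof.
elim: w => // x w IH; rewrite delta_cons; case: ifP => _ //=.
exact: leq_trans IH (leqnSn _).
Qed.

Lemma delta_sub w : subseq (delta w) w.
Proof.
elim: w => // x w IH; rewrite delta_cons; case: ifP => _ /=; last by rewrite eqxx.
exact: subseq_trans IH (subseq_cons _ _).
Qed.

(** The fixed points of [delta] are the words without equal neighbours: a repeated head would be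
    dropped and make the result too short. *)
Lemma delta_id_cons x w :
  delta (x :: w) = x :: w <-> ohead w != Some x /\ delta w = w.
Proof.
rewrite delta_cons; case: ifPn => [hx|hx].
  split=> [E|[]//]; have := size_delta w; by rewrite E ltnn.
by split=> [[]//|[_ ->]].
Qed.

Lemma delta_idem w : delta (delta w) = delta w.
Proof.
elim: w => // x w IH; rewrite delta_cons; case: ifPn => // hx.
by apply/delta_id_cons; rewrite ohead_delta.
Qed.

(** A word without equal neighbours uses at most one letter of each block of equal letters, so its
    embedding survives the collapse. *)
Lemma sub_delta u w : delta u = u -> subseq u w -> subseq u (delta w).
Proof.
elim: w u => // x w IH [|y u] hu; first by move=> _; exact: sub0seq.
rewrite delta_cons [subseq _ (x :: w)]/=; have [yx|yx] := eqVneq y x.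
  subst y; case/delta_id_cons: (hu) => hx hu'.
  case: ifP => [|_ uw]; last by rewrite /= eqxx IH.
  move=> /eqP wx uw; apply: IH => //; case: w wx uw => //= z w [->].
  rewrite eqxx; case: u {hu hu'} hx => [|t u] /=; first by rewrite sub0seq.
  by rewrite (inj_eq Some_inj) => /negPf ->.
case: ifP => _ h; first exact: IH.
exact: subseq_trans (IH _ hu h) (subseq_cons _ _).
Qed.

Lemma delta_mono u w : subseq u w -> subseq (delta u) (delta w).
Proof.
move=> h; apply: sub_delta; first exact: delta_idem.
exact: subseq_trans (delta_sub u) h.
Qed.

Lemma size_delta_gt S w :
  delta S = S -> subseq S w -> delta w <> S -> size S < size (delta w).
Proof.
move=> hS hw ne; have h := sub_delta hS hw.
have := size_subseq h; rewrite leq_eqVlt => /orP[/eqP E|//].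
by case: ne; apply/esym/eqP; rewrite -(size_subseq_leqif h) E.
Qed.

(** The collapse is monotone for subwords, so once it has outgrown [S] it stays longer. This is why
    the faces whose complement does not collapse to [S] form a subcomplex. *)
Lemma delta_neq_mono S u w : delta S = S -> subseq S u -> subseq u w ->
  delta u <> S -> delta w <> S.
Proof.
move=> hS Su uw ne E; have := size_delta_gt hS Su ne.
by rewrite ltnNge -E size_subseq // delta_mono.
Qed.

(** If [delta w] were [q :: S], then [delta u] would be a subword of it longer than [S], hence all
    of it. This makes the set [E] of the gluing step closed. *)
Lemma delta_neq_behead q S u w : delta (q :: S) = q :: S ->
  subseq S u -> subseq u w -> delta u <> S -> delta u <> q :: S ->
  delta w <> q :: S.
Proof.
move=> hqS Su uw ne ne' E; have hS : delta S = S by case/delta_id_cons: hqS.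
apply: ne'; have := delta_mono uw; rewrite E => h.
apply/eqP; rewrite -(size_subseq_leqif h) eqn_leq size_subseq //=.
exact: size_delta_gt.
Qed.

Lemma subseq_cons_neq q S w : ohead S != Some q ->
  subseq S (q :: w) = subseq S w.
Proof. by case: S => [|x S] /=; rewrite ?sub0seq // (inj_eq Some_inj) => /negPf ->. Qed.

Lemma subseq_behead q S w : subseq (q :: S) w -> subseq S w.
Proof. exact: subseq_trans (subseq_cons _ _). Qed.

Lemma delta_cons_neq q S w : ohead S != Some q -> delta (q :: w) <> S.
Proof. by move=> + E; rewrite -E ohead_delta eqxx. Qed.

(** If the leading [q] merges, both sides fail: [delta w] starts with [q], unlike [S], and
    [delta (q :: w)] is a subword of [w], unlike [q :: S]. *)
Lemma delta_cons_nsub q S w : delta (q :: S) = q :: S -> ~~ subseq (q :: S) w ->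
  delta (q :: w) = q :: S <-> delta w = S.
Proof.
case/delta_id_cons=> hq hS nw; rewrite delta_cons; case: ifP => [hw|_].
  split=> E; first by rewrite -E delta_sub in nw.
  by move: hq; rewrite -E ohead_delta hw.
by split=> [[]|->].
Qed.

(** If the leading [q] does not merge, both sides fail: [S] is too short to be [delta w], which
    contains [q :: S], and [delta w = q :: S] would make [q] merge. *)
Lemma delta_cons_sub q S w : delta (q :: S) = q :: S -> subseq (q :: S) w ->
  delta (q :: w) = q :: S <-> delta w = q :: S.
Proof.
move=> hqS /(sub_delta hqS) sw; rewrite delta_cons; case: ifPn => // hw.
split=> [[E]|E]; first by have := size_subseq sw; rewrite E ltnn.
by move: hw; rewrite -ohead_delta E eqxx.
Qed.

(** The positions of such a [u] are the complement of a boundary ridge. In the induction the first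
    letter [q] of [w] is put before [S] when [S] does not start with [q]; otherwise it is skipped or
    matched, according to whether the rest still contains [S]. *)
Lemma ex_reduced_extension S w : delta S = S -> subseq S w -> delta w <> S ->
  exists u, [/\ subseq u w, size u = (size S).+1, subseq S u & delta u = u].
Proof.
elim: w S => [|q w IH] S hS; first by rewrite subseq0 => /eqP ->.
have [hq|hq] := boolP (ohead S == Some q); last first.
  rewrite subseq_cons_neq // => Sw _; exists (q :: S).
  split; [by rewrite /= eqxx|by []|exact: subseq_cons|exact/delta_id_cons].
case: S hS hq => // x S hS /eqP[xq]; subst x; rewrite /= eqxx => Sw ne.
have hS' : delta S = S by case/delta_id_cons: hS.
have [qSw|nSw] := boolP (subseq (q :: S) w).
  have [|u [uw su Su hu]] := IH _ hS qSw; first by rewrite -(delta_cons_sub hS).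
  by exists u; split=> //; apply: subseq_trans uw (subseq_cons _ _).
have [|u [uw su Su hu]] := IH _ hS' Sw; first by rewrite -(delta_cons_nsub hS).
exists (q :: u); split; rewrite /= ?eqxx ?su //.
apply/delta_id_cons; split=> //.
(* If [u] started with [q], counting letters would force its tail to be [S], and [q :: S] would
   embed in [w]. *)
apply: contra nSw; case: u uw su Su {hu} => // x u uw [su] Su /eqP[xq].
move: Su; rewrite xq; rewrite subseq_cons_neq; last by case/delta_id_cons: hS.
move=> h; have /eqP -> : S == u by rewrite -(size_subseq_leqif h) su.
by rewrite -xq.
Qed.

Variables (I : eqType) (l : I -> T).
Implicit Types (s : seq I) (p : I).

(** Deletions at two different places agree only if all letters from one place to the other are
    equal, which is impossible without equal neighbours. Hence the facet over a boundary ridge is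
    unique. *)
Lemma map_rem_inj s p p' : delta (map l s) = map l s ->
  p \in s -> p' \in s -> map l (rem p s) = map l (rem p' s) -> p = p'.
Proof.
elim: s => // i s IH; rewrite map_cons => /delta_id_cons[hi hs]; rewrite !inE /=.
have aux p1 : map l s <> l i :: map l (rem p1 s).
  by move=> E; move: hi; rewrite E eqxx.
have [ip|ip] := eqVneq i p; have [ip'|ip'] := eqVneq i p' => /=.
- by rewrite -ip -ip'.
- by move=> _ hp' /aux; case.
- by move=> hp _ /esym /aux; case.
by move=> hp hp' [/IH]; apply.
Qed.

Lemma ex_rem_subseq s S : uniq s -> size s = (size S).+1 ->
  subseq S (map l s) -> exists2 p, p \in s & map l (rem p s) = S.
Proof.
elim: s S => // i s IH S /andP[si us] [sz].
have full : subseq S (map l s) ->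
    exists2 p, p \in i :: s & map l (rem p (i :: s)) = S.
  move=> h; exists i; rewrite ?mem_head //= eqxx; apply/esym/eqP.
  by rewrite -(size_subseq_leqif h) size_map sz.
case: S sz full => [|x S] sz full; first by rewrite sub0seq in full *; apply: full.
rewrite map_cons [subseq _ (_ :: _)]/=; case: eqP => [-> h|_ //].
have [p ps E] := IH S us sz h; exists p; first by rewrite inE ps orbT.
have ip : i != p by apply: contraNneq si => ->.
by rewrite /= (negPf ip) map_cons E.
Qed.

(** The collapse loses a single letter, so there is one pair of equal neighbours, and deleting
    either of them gives [S]. A ridge with such a complement lies in two facets. *)
Lemma ex_rem_pair s S : uniq s -> delta S = S -> size s = (size S).+1 ->
  delta (map l s) = S -> exists p p',
    [/\ p != p', p \in s, p' \in s, map l (rem p s) = S & map l (rem p' s) = S].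
Proof.
elim: s S => // i s IH S /andP[si us] hS [sz].
rewrite map_cons delta_cons; case: ifP => [|_].
  case: s sz us si {IH} => // j s sz us si /eqP[lji] E.
  have {}E : map l (j :: s) = S.
    apply/esym/eqP; have h : subseq S (map l (j :: s)) by rewrite -E delta_sub.
    by rewrite -(size_subseq_leqif h) size_map sz.
  exists i, j; rewrite !inE !eqxx orbT; move: si; rewrite inE negb_or => /andP[ij _].
  by rewrite /= (negPf ij) !eqxx -E /= lji.
case: S hS sz => // x S /delta_id_cons[_ hS] sz [xi E].
have [//|p [p' [pp ps ps' E1 E2]]] := IH S us hS _ E; exists p, p'.
have ip q : q \in s -> i != q by move=> qs; apply: contraNneq si => ->.
by rewrite !inE ps ps' !orbT /= !ifN ?ip //= E1 E2 xi.
Qed.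

End Words.

(** * The combinatorial boundary of the slide complex *)

Section Boundary.
Local Open Scope nat_scope.
Local Open Scope set_scope.
Variables (T : eqType) (Q S : seq T).
Implicit Types (P F G H : {set 'I_(size Q)}).
Local Notation K := (slide_complex Q S).

Lemma enum_filter P P' : P \subset P' -> enum P = [seq i <- enum P' | i \in P].
Proof.
move=> /fintype.subsetP PP'; rewrite /enum_mem -filter_predI; apply: eq_filter => i /=.
by rewrite andb_idr // => /PP'.
Qed.

Lemma word_at_mono P P' : P \subset P' -> subseq (word_at P) (word_at P').
Proof. by move=> h; rewrite /word_at (enum_filter h) map_subseq ?filter_subseq. Qed.

Lemma word_at_subseq u P : subseq u (word_at P) ->
  exists2 P' : {set 'I_(size Q)}, P' \subset P & word_at P' = u.
Proof.
case/subseqP => b sb ->; pose s := mask b (enum P).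
have ss : subseq s (enum P) by apply: mask_subseq.
have sP : [set i in s] \subset P.
  by apply/fintype.subsetP => i; rewrite inE => /(mem_subseq ss); rewrite mem_enum.
exists [set i in s] => //; rewrite /word_at (enum_filter sP) -map_mask -/s.
congr map; have /esym sE : s = [seq i <- enum P | i \in s].
  by apply/subseq_uniqP; rewrite ?enum_uniq.
by rewrite -[RHS]sE; apply: eq_filter => i; rewrite inE.
Qed.

Lemma size_word_at P : size (word_at P) = #|P|.
Proof. by rewrite size_map -cardE. Qed.

Lemma word_atD1 p P :
  word_at (P :\ p) = map (tnth (in_tuple Q)) (rem p (enum P)).
Proof.
rewrite /word_at (enum_filter (finset.subD1set P p)) rem_filter ?enum_uniq //.
congr (map _ _); apply: eq_in_filter => i; rewrite mem_enum /= => iP.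
by rewrite !inE iP andbT.
Qed.

(** A face is maximal when its complement has no letter to spare beyond one copy of [S]. *)
Lemma slide_facetP H : maxset (fun A => A \in K) H <-> word_at (~: H) = S.
Proof.
split=> [/maxsetP[]|E].
  rewrite inE => /word_at_subseq[P' P'H E] mx; rewrite -E; congr word_at.
  rewrite -(mx (~: P')) ?finset.setCK //; first by rewrite inE finset.setCK E.
  by rewrite -finset.setCS finset.setCK.
apply/maxsetP; split=> [|H']; rewrite inE ?E // => SH' HH'.
apply/eqP; rewrite eq_sym eqEcard HH' /=.
have := size_subseq SH'; rewrite -E !size_word_at.
by rewrite -(leq_add2l #|H'|) finset.cardsC -(finset.cardsC H) leq_add2r.
Qed.

Hypothesis hS : delta S = S.

Lemma facets_containingP P H :
  H \in facets_containing K (~: P) <-> ~: H \subset P /\ word_at (~: H) = S.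
Proof.
rewrite inE -finset.setCS finset.setCK; split=> [/andP[/slide_facetP]|[-> /slide_facetP ->]] //.
Qed.

(** The complement of a ridge exceeds [S] by one letter. If it collapses to [S], either of two equal
    neighbours can be deleted, giving two facets; otherwise it has no equal neighbours and the
    deletion is unique. *)
Lemma boundary_ridgeP P :
  boundary_ridge K (~: P) <->
  [/\ subseq S (word_at P), #|P| = (size S).+1 & delta (word_at P) <> S].
Proof.
have szC H : #|~: H| + #|H| = #|P| + #|~: P| by rewrite addnC !finset.cardsC.
rewrite /boundary_ridge inE finset.setCK; split.
  case/andP=> SP /existsP[H /andP[/eqP fH /eqP cH]].
  have /facets_containingP[HP wH] : H \in facets_containing K (~: P).
    by rewrite fH inE.
  have cP : #|P| = (size S).+1.
    by have := szC H; rewrite -size_word_at wH cH addnS -addSn => /addIn.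
  split=> // dP.
  have [p [p' [pp pP pP' E E']]] := ex_rem_pair (enum_uniq P) hS
    (etrans (esym (cardE P)) cP) dP.
  have H1 q : q \in enum P -> map (tnth (in_tuple Q)) (rem q (enum P)) = S ->
      ~: H = P :\ q.
    rewrite -word_atD1 => _ wq; have : ~: (P :\ q) \in [set H].
      by rewrite -fH; apply/facets_containingP; rewrite finset.setCK finset.subD1set.
    by rewrite inE => /eqP <-; rewrite finset.setCK.
  have := H1 _ pP' E'; rewrite (H1 _ pP E) => /finset.setP/(_ p).
  by rewrite !inE eqxx pp -mem_enum pP.
case=> SP cP dP; rewrite SP /=.
have [p pP E] := ex_rem_subseq (enum_uniq P) (etrans (esym (cardE P)) cP) SP.
(* The collapse is longer than [S], so it has full length and no letter was lost. *)
have dw : delta (word_at P) = word_at P.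
  apply/eqP; rewrite -(size_subseq_leqif (delta_sub _)).
  rewrite eqn_leq size_delta size_word_at cP.
  exact: size_delta_gt.
have wp : word_at (P :\ p) = S by rewrite word_atD1.
have pP' : p \in P by rewrite -mem_enum.
apply/existsP; exists (~: (P :\ p)); apply/andP; split; last first.
  apply/eqP; have := szC (~: (P :\ p)); rewrite finset.setCK -size_word_at wp cP.
  by rewrite addSn -addnS => /addnI.
apply/eqP/finset.setP => H; rewrite [RHS]inE; apply/idP/eqP; last first.
  by move=> ->; apply/facets_containingP; rewrite finset.setCK finset.subD1set.
case/facets_containingP=> HP wH; rewrite -[H]finset.setCK; congr (~: _).
(* The complement of a facet is smaller than [P], so it misses some [q] of [P]; by cardinality it is
   [P :\ q]. *)
have [q qP] : exists2 q, q \in P & q \notin ~: H.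
  apply/fintype.subsetPn; apply: contraTN isT => PH.
  by have := subset_leq_card PH; rewrite cP -size_word_at wH ltnn.
move=> qH; have EH : ~: H = P :\ q.
  apply/eqP; rewrite eqEcard; apply/andP; split.
    apply/fintype.subsetP => i iH; rewrite !inE (fintype.subsetP HP _ iH) andbT.
    by apply: contraNneq qH => <-.
  have := finset.cardsD1 q P; rewrite qP cP add1n => -[<-].
  by rewrite -size_word_at wH.
rewrite EH; congr (P :\ _); apply: (map_rem_inj dw) => //; rewrite ?mem_enum //.
by rewrite E -word_atD1 -EH.
Qed.

(** A complement that does not collapse to [S] contains a word without equal neighbours one letter
    longer than [S], and its positions are the complement of a boundary ridge above the face.
    Conversely, the failure to collapse to [S] passes to larger complements. *)
Lemma slide_boundaryP P : ~: P \in K ->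
  (~: P \in boundary_complex K <-> delta (word_at P) <> S).
Proof.
rewrite inE finset.setCK => SP; rewrite !inE finset.setCK SP /=; split.
  case/existsP=> G /andP[]; rewrite -[G]finset.setCK => /boundary_ridgeP[SG _ dG].
  rewrite finset.setCS => GP; exact: (delta_neq_mono hS SG (word_at_mono GP) dG).
move=> /(ex_reduced_extension hS SP)[u [uP su Su hu]].
have [P' P'P E] := word_at_subseq uP.
apply/existsP; exists (~: P'); rewrite finset.setCS P'P andbT; apply/boundary_ridgeP.
rewrite -size_word_at E su hu; split=> // E'; move: su; rewrite E'.
by move=> /n_Sn.
Qed.

End Boundary.

(** * Continuity on a subset *)

Section WithinContinuity.
Local Open Scope classical_set_scope.
Local Open Scope ring_scope.
Variable R : realType.

Lemma within_continuousP (T U : topologicalType) (A : set T) (f : T -> U) :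
  {within A, continuous f} <->
  forall x, A x -> f @ within A (nbhs x) --> f x.
Proof. exact: subspace_continuousP. Qed.

Section General.
Variables (T U V : topologicalType).
Implicit Types (A B : set T).

Lemma within_continuous_sub A B (f : T -> U) : A `<=` B ->
  {within B, continuous f} -> {within A, continuous f}.
Proof. exact: continuous_subspaceW. Qed.

Lemma within_continuous_ext A (f g : T -> U) : (forall x, A x -> f x = g x) ->
  {within A, continuous f} -> {within A, continuous g}.
Proof.
move=> fg cf; apply: subspace_eq_continuous cf => x; rewrite inE; exact: fg.
Qed.

Lemma within_continuous_trans A (B : set U) (f : T -> U) (g : U -> V) :
  (forall x, A x -> B (f x)) -> {within B, continuous g} ->
  {within A, continuous f} -> {within A, continuous (fun x => g (f x))}.
Proof.
move=> AB /within_continuousP cg /within_continuousP cf.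
apply/within_continuousP => x Ax W /(cg _ (AB x Ax)); rewrite /within /= => gW.
have := cf x Ax _ gW; rewrite /within /= !nbhs_filterE => /= h.
by apply: filterS h => t ht At; apply: ht At (AB _ At).
Qed.

Lemma closed_preimageT (f : T -> U) (C : set U) :
  continuous f -> closed C -> closed [set x | C (f x)].
Proof. by move=> cf; apply: preimage_closed => x _; exact: cf. Qed.

End General.

Section Real.
Variables (T : topologicalType) (A : set T).
Implicit Types (f g : T -> R).

Lemma within_continuousD f g : {within A, continuous f} ->
  {within A, continuous g} -> {within A, continuous (fun x => f x + g x)}.
Proof.
move=> /within_continuousP cf /within_continuousP cg.
apply/within_continuousP => x Ax; apply: cvgD; [exact: cf|exact: cg].
Qed.

Lemma within_continuousB f g : {within A, continuous f} ->
  {within A, continuous g} -> {within A, continuous (fun x => f x - g x)}.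
Proof.
move=> /within_continuousP cf /within_continuousP cg.
apply/within_continuousP => x Ax; apply: cvgB; [exact: cf|exact: cg].
Qed.

Lemma within_continuousM f g : {within A, continuous f} ->
  {within A, continuous g} -> {within A, continuous (fun x => f x * g x)}.
Proof.
move=> /within_continuousP cf /within_continuousP cg.
apply/within_continuousP => x Ax; apply: cvgM; [exact: cf|exact: cg].
Qed.

Lemma within_continuousV f : (forall x, A x -> f x != 0) ->
  {within A, continuous f} -> {within A, continuous (fun x => (f x)^-1)}.
Proof.
move=> f0 /within_continuousP cf.
apply/within_continuousP => x Ax; apply: cvgV; [exact: f0|exact: cf].
Qed.

Lemma within_continuous_norm f : {within A, continuous f} ->
  {within A, continuous (fun x => `|f x|)}.
Proof.
move=> /within_continuousP cf.
apply/within_continuousP => x Ax; apply: cvg_norm; exact: cf.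
Qed.

Lemma within_continuous_cst (c : R) : {within A, continuous (fun=> c)}.
Proof. by apply/within_continuousP => x Ax; apply: cvg_cst. Qed.

Lemma within_continuous_min f g : {within A, continuous f} ->
  {within A, continuous g} ->
  {within A, continuous (fun x => Num.min (f x) (g x))}.
Proof.
move=> cf cg.
apply: (@within_continuous_ext _ _ _ (fun x => (f x + g x - `|f x - g x|) * 2^-1)).
  by move=> x _; rewrite minr_absE.
apply: within_continuousM; last exact: within_continuous_cst.
apply: within_continuousB; first exact: within_continuousD.
by apply: within_continuous_norm; apply: within_continuousB.
Qed.

Lemma within_continuous_max f g : {within A, continuous f} ->
  {within A, continuous g} ->
  {within A, continuous (fun x => Num.max (f x) (g x))}.
Proof.
move=> cf cg.
apply: (@within_continuous_ext _ _ _ (fun x => (f x + g x + `|f x - g x|) * 2^-1)).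
  by move=> x _; rewrite maxr_absE.
apply: within_continuousM; last exact: within_continuous_cst.
apply: within_continuousD; first exact: within_continuousD.
by apply: within_continuous_norm; apply: within_continuousB.
Qed.

Lemma within_continuous_sum (I : finType) (F : I -> T -> R) :
  (forall i, {within A, continuous F i}) ->
  {within A, continuous (fun x => \sum_i F i x)}.
Proof.
move=> cF; elim: (index_enum I) => [|i r IH].
  apply: (@within_continuous_ext _ _ _ (fun=> 0)); last exact: within_continuous_cst.
  by move=> x _; rewrite big_nil.
apply: (@within_continuous_ext _ _ _ (fun x => F i x + \sum_(i <- r) F i x)).
  by move=> x _; rewrite big_cons.
exact: within_continuousD.
Qed.

Lemma within_continuous_rV n (f : T -> 'rV[R]_n) :
  (forall j, {within A, continuous (fun x => f x 0 j)}) ->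
  {within A, continuous f}.
Proof.
move=> cf; apply/within_continuousP => x Ax W [P Pn PW].
have h j : (within A (nbhs x)) [set t | P 0 j (f t 0 j)].
  by have /within_continuousP/(_ x Ax) := cf j; apply; apply: Pn.
rewrite nbhs_filterE; suff : within A (nbhs x) (f @^-1` W) by [].
apply: filterS (filter_forall _ h) => t ht.
by apply: PW => i j; rewrite ord1; apply: ht.
Qed.

End Real.
End WithinContinuity.

(** * Splitting off the first coordinate *)

Section RowCons.
Local Open Scope ring_scope.
Variable R : realType.

Definition vhead n (x : 'rV[R]_n.+1) : R := x 0 ord0.
Definition vtail n (x : 'rV[R]_n.+1) : 'rV[R]_n := \row_j x 0 (lift ord0 j).
Definition vcons n (a : R) (x : 'rV[R]_n) : 'rV[R]_n.+1 :=
  \row_j if unlift ord0 j is Some i then x 0 i else a.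

Lemma vconsK n a (x : 'rV[R]_n) : vtail (vcons a x) = x.
Proof. by apply/rowP => j; rewrite !mxE liftK. Qed.

Lemma vhead_cons n a (x : 'rV[R]_n) : vhead (vcons a x) = a.
Proof. by rewrite /vhead mxE unlift_none. Qed.

Lemma vcons_eta n (x : 'rV[R]_n.+1) : vcons (vhead x) (vtail x) = x.
Proof.
by apply/rowP => j; rewrite mxE; case: unliftP => [i|] ->; rewrite ?mxE.
Qed.

Lemma vconsZ n c a (x : 'rV[R]_n) : vcons (c * a) (c *: x) = c *: vcons a x.
Proof. by apply/rowP => j; rewrite !mxE; case: unliftP => [i|] _; rewrite ?mxE. Qed.

Lemma vheadZ n c (x : 'rV[R]_n.+1) : vhead (c *: x) = c * vhead x.
Proof. by rewrite /vhead mxE. Qed.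

Lemma vtailZ n c (x : 'rV[R]_n.+1) : vtail (c *: x) = c *: vtail x.
Proof. by apply/rowP => j; rewrite !mxE. Qed.

End RowCons.

(** * Homogeneous homeomorphisms of cones *)

Section ConeHomeo.
Local Open Scope classical_set_scope.
Local Open Scope ring_scope.
Variable R : realType.

Section Continuity.
Variables (T : topologicalType) (A : set T).

Lemma within_continuous_coord n (f : T -> 'rV[R]_n) j :
  {within A, continuous f} -> {within A, continuous (fun x => f x 0 j)}.
Proof.
move=> cf.
apply: (within_continuous_trans (B := setT) (g := fun M : 'rV[R]_n => M 0 j))
  cf => //.
by apply: continuous_subspaceT => M; apply: coord_continuous.
Qed.

Lemma within_continuous_vhead n (f : T -> 'rV[R]_n.+1) :
  {within A, continuous f} -> {within A, continuous (fun x => vhead (f x))}.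
Proof. exact: within_continuous_coord. Qed.

Lemma within_continuous_vtail n (f : T -> 'rV[R]_n.+1) :
  {within A, continuous f} -> {within A, continuous (fun x => vtail (f x))}.
Proof.
move=> cf; apply: within_continuous_rV => j.
apply: (within_continuous_ext (f := fun x => f x 0 (lift ord0 j))).
  by move=> x _; rewrite mxE.
exact: within_continuous_coord.
Qed.

Lemma within_continuous_vcons n (u : T -> R) (f : T -> 'rV[R]_n) :
  {within A, continuous u} -> {within A, continuous f} ->
  {within A, continuous (fun x => vcons (u x) (f x))}.
Proof.
move=> cu cf; apply: within_continuous_rV => j; case: (unliftP ord0 j) => [i|] ->.
  apply: (within_continuous_ext (f := fun x => f x 0 i)).
    by move=> x _; rewrite mxE liftK.
  exact: within_continuous_coord.
apply: (within_continuous_ext (f := u)) => // x _.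
by rewrite mxE unlift_none.
Qed.

End Continuity.

Lemma continuousT (T U : topologicalType) (f : T -> U) :
  {within setT, continuous f} -> continuous f.
Proof.
move=> /within_continuousP cf x W /(cf x I); rewrite /within /= !nbhs_filterE => h.
have {}h : \forall t \near x, True -> W (f t) by [].
by apply: (filterS _ h) => t; apply.
Qed.

Definition scale_invariant m (A : set 'rV[R]_m) :=
  forall c x, 0 < c -> A x -> A (c *: x).

(** Homogeneity is asked of [f]; for scale invariant [A] it carries over to [g]. *)
Definition cone_homeo m n (A : set 'rV[R]_m) (B : set 'rV[R]_n) f g :=
  [/\ {within A, continuous f}, {within B, continuous g},
      forall x, A x -> B (f x) /\ g (f x) = x,
      forall y, B y -> A (g y) /\ f (g y) = y
    & forall c x, 0 < c -> A x -> f (c *: x) = c *: f x].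

Definition half_space n : set 'rV[R]_n.+1 := [set y | 0 <= vhead y].
(** The product with a ray is the cone over the join of a complex with a new vertex. *)
Definition join_ray m (A : set 'rV[R]_m) : set 'rV[R]_m.+1 :=
  [set x | 0 <= vhead x /\ A (vtail x)].

Lemma scale_invariantZ m (A : set 'rV[R]_m) c x : scale_invariant A -> 0 < c ->
  A (c *: x) <-> A x.
Proof.
move=> hA c0; split=> [|/(hA _ _ c0)//].
by move=> /(hA c^-1); rewrite invr_gt0 scalerA mulVf ?gt_eqF // scale1r; apply.
Qed.

Lemma cone_homeoVZ m n (A : set 'rV[R]_m) (B : set 'rV[R]_n) f g :
  scale_invariant A -> cone_homeo A B f g ->
  forall c y, 0 < c -> B y -> g (c *: y) = c *: g y.
Proof.
move=> hA [_ _ fg gf fZ] c y c0 By; have [Ag <-] := gf _ By.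
by rewrite -fZ // (fg _ (hA _ _ c0 Ag)).2 (gf _ By).2.
Qed.

Section Joins.
Variables (m n : nat) (A : set 'rV[R]_m).

Lemma within_continuous_id (T : topologicalType) (B : set T) :
  {within B, continuous (@id T)}.
Proof. by apply: continuous_subspaceT => x. Qed.

Lemma within_vtail k (B : set 'rV[R]_k.+1) : {within B, continuous (@vtail R k)}.
Proof. by apply: within_continuous_vtail; apply: within_continuous_id. Qed.

Lemma within_vhead k (B : set 'rV[R]_k.+1) : {within B, continuous (@vhead R k)}.
Proof. by apply: within_continuous_vhead; apply: within_continuous_id. Qed.

(** A space times a ray is a half space whose height is the ray coordinate. *)
Lemma cone_homeo_join_sphere f g : cone_homeo A (@setT 'rV[R]_n) f g ->
  cone_homeo (join_ray A) (@half_space n)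
    (fun x => vcons (vhead x) (f (vtail x))) (fun y => vcons (vhead y) (g (vtail y))).
Proof.
move=> [cf cg fg gf fZ]; split.
- apply: within_continuous_vcons; first exact: within_vhead.
  apply: within_continuous_trans cf _; last exact: within_vtail.
  by move=> x [].
- apply: within_continuous_vcons; first exact: within_vhead.
  by apply: within_continuous_trans cg _ => //; apply: within_vtail.
- move=> x [x0 Ax]; rewrite /half_space /= !vhead_cons !vconsK (fg _ Ax).2.
  by rewrite vcons_eta.
- move=> y y0; have [Ag fgy] := gf (vtail y) I.
  by rewrite /join_ray /= !vhead_cons !vconsK fgy vcons_eta.
- by move=> c x c0 [x0 Ax]; rewrite vheadZ vtailZ fZ // vconsZ.
Qed.

(* (h, a) |-> (min h a, h - a) unfolds a quadrant onto a half plane *)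
Lemma cone_homeo_join_ball f g : cone_homeo A (@half_space n) f g ->
  cone_homeo (join_ray A) (@half_space n.+1)
    (fun x => let h := vhead (f (vtail x)) in let a := vhead x in
       vcons (Num.min h a) (vcons (h - a) (vtail (f (vtail x)))))
    (fun y => let t := vhead y in let d := vhead (vtail y) in
       vcons (t + Num.max (- d) 0) (g (vcons (t + Num.max d 0) (vtail (vtail y))))).
Proof.
move=> [cf cg fg gf fZ].
have cft : {within join_ray A, continuous (fun x => f (vtail x))}.
  by apply: within_continuous_trans cf _ => [x []//|]; apply: within_vtail.
have mx0 (d : R) : 0 <= Num.max d 0 by rewrite le_max lexx orbT.
have ct k (B : set 'rV[R]_k.+2) : {within B, continuous (fun x => vhead (vtail x))}.
  by apply: within_continuous_vhead; apply: within_vtail.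
have c0 k (B : set 'rV[R]_k) : {within B, continuous (fun=> 0 : R)}.
  exact: within_continuous_cst.
split.
- apply: within_continuous_vcons.
    by apply: within_continuous_min; [apply: within_continuous_vhead|apply: within_vhead].
  apply: within_continuous_vcons; last exact: within_continuous_vtail.
  by apply: within_continuousB; [apply: within_continuous_vhead|apply: within_vhead].
- apply: within_continuous_vcons.
    apply: within_continuousD; first exact: within_vhead.
    apply: within_continuous_max => //.
    apply: (within_continuous_ext (f := fun x => 0 - vhead (vtail x))).
      by move=> x _; rewrite sub0r.
    exact: within_continuousB.
  apply: within_continuous_trans cg _.
    by move=> y /= y0; rewrite /half_space /= vhead_cons addr_ge0.
  apply: within_continuous_vcons; last first.
    by apply: within_continuous_vtail; apply: within_vtail.
  by apply: within_continuousD; [apply: within_vhead|apply: within_continuous_max].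
- move=> x [x0 Ax]; have [fx gfx] := fg _ Ax.
  rewrite /half_space /= in fx *; rewrite !(vhead_cons, vconsK) le_min fx x0.
  split=> //; set h := vhead (f _); set a := vhead x.
  (* Adding the positive part of the difference, with either sign, to the minimum recovers [a] and
     [h]. *)
  have -> : Num.min h a + Num.max (- (h - a)) 0 = a.
    by rewrite maxEle minEle; do ?case: ifPn; lra.
  have -> : Num.min h a + Num.max (h - a) 0 = h.
    by rewrite maxEle minEle; do ?case: ifPn; lra.
  by rewrite vcons_eta gfx vcons_eta.
- move=> y y0; set t := vhead y; set d := vhead _.
  have hs : half_space (vcons (t + Num.max d 0) (vtail (vtail y))).
    by rewrite /half_space /= vhead_cons addr_ge0.
  have [Ag fgy] := gf _ hs.
  rewrite /join_ray /= !vhead_cons !vconsK fgy vhead_cons vconsK addr_ge0 //.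
  split=> //.
  have -> : Num.min (t + Num.max d 0) (t + Num.max (- d) 0) = t.
    by rewrite !maxEle minEle; do ?case: ifPn; lra.
  have -> : t + Num.max d 0 - (t + Num.max (- d) 0) = d.
    by rewrite !maxEle; do ?case: ifPn; lra.
  by rewrite !vcons_eta.
- move=> c x cpos [x0 Ax]; rewrite /= !vheadZ !vtailZ !fZ // !vheadZ !vtailZ.
  by rewrite -!vconsZ minr_pMr ?ltW // mulrBr.
Qed.

(** For a first letter that every copy of the subword must use: its coordinate is forced to be 0. *)
Lemma cone_homeo_zero (B : set 'rV[R]_n) f g : cone_homeo A B f g ->
  cone_homeo [set x | vhead x = 0 /\ A (vtail x)] B
    (fun x => f (vtail x)) (fun y => vcons 0 (g y)).
Proof.
move=> [cf cg fg gf fZ]; split.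
- by apply: within_continuous_trans cf _ => [x []//|]; apply: within_vtail.
- by apply: within_continuous_vcons cg; apply: within_continuous_cst.
- by move=> x [x0 Ax]; have [Bx ->] := fg _ Ax; rewrite -[in RHS](vcons_eta x) x0.
- by move=> y By; have [Ag fgy] := gf _ By; rewrite /= vhead_cons vconsK.
- by move=> c x c0 [x0 Ax]; rewrite vtailZ fZ.
Qed.

(** The rays over the bounding hyperplane are turned to the negative heights. Height and ray
    coordinate are never both nonzero, so they are the positive and the negative part of their
    difference. *)
Lemma cone_homeo_glue_sphere f g :
  cone_homeo A (@half_space n) f g ->
  cone_homeo [set x : 'rV[R]_m.+1 | [/\ 0 <= vhead x, A (vtail x) &
      vhead x <> 0 -> vhead (f (vtail x)) = 0]] (@setT 'rV[R]_n.+1)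
    (fun x => vcons (vhead (f (vtail x)) - vhead x) (vtail (f (vtail x))))
    (fun y => vcons (Num.max (- vhead y) 0)
       (g (vcons (Num.max (vhead y) 0) (vtail y)))).
Proof.
move=> [cf cg fg gf fZ].
set X := [set x | _].
have cft : {within X, continuous (fun x => f (vtail x))}.
  by apply: within_continuous_trans cf _ => [x []//|]; apply: within_vtail.
have mx0 (d : R) : 0 <= Num.max d 0 by rewrite le_max lexx orbT.
have c0 k (B : set 'rV[R]_k) : {within B, continuous (fun=> 0 : R)}.
  exact: within_continuous_cst.
split.
- apply: within_continuous_vcons; last exact: within_continuous_vtail.
  by apply: within_continuousB; [apply: within_continuous_vhead|apply: within_vhead].
- apply: within_continuous_vcons.
    apply: within_continuous_max => //.
    apply: (within_continuous_ext (f := fun x => 0 - vhead x)).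
      by move=> x _; rewrite sub0r.
    by apply: within_continuousB => //; apply: within_vhead.
  apply: within_continuous_trans cg _.
    by move=> y _; rewrite /half_space /= vhead_cons.
  apply: within_continuous_vcons; last exact: within_vtail.
  by apply: within_continuous_max => //; apply: within_vhead.
- move=> x [x0 Ax x1]; have [fx gfx] := fg _ Ax; split=> //.
  rewrite /half_space /= in fx; rewrite !(vhead_cons, vconsK).
  set h := vhead (f _); set a := vhead x.
  have ha : a = 0 \/ h = 0 by have [|/eqP/x1] := eqVneq a 0; [left|right].
  have -> : Num.max (- (h - a)) 0 = a.
    by rewrite maxEle; case: ifPn; rewrite -/a -/h in x0 fx *; case: ha; lra.
  have -> : Num.max (h - a) 0 = h.
    by rewrite maxEle; case: ifPn; rewrite -/a -/h in x0 fx *; case: ha; lra.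
  by rewrite vcons_eta gfx vcons_eta.
- move=> y _; set d := vhead _.
  have hs : half_space (vcons (Num.max d 0) (vtail y)).
    by rewrite /half_space /= vhead_cons.
  have [Ag fgy] := gf _ hs.
  rewrite /X /= !vhead_cons !vconsK fgy vhead_cons vconsK; split.
    by split=> //; rewrite !maxEle; do ?case: ifPn; lra.
  have -> : Num.max d 0 - Num.max (- d) 0 = d.
    by rewrite !maxEle; do ?case: ifPn; lra.
  exact: vcons_eta.
- move=> c x ? [x0 Ax _]; rewrite !vheadZ !vtailZ !fZ // !vheadZ !vtailZ.
  by rewrite -!vconsZ mulrBr.
Qed.

End Joins.
End ConeHomeo.

(** * Attaching rays along part of the boundary of a half space *)

Section GlueBall.
Local Open Scope classical_set_scope.
Local Open Scope ring_scope.
Variable R : realType.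
Variables (m n k : nat) (A D E : set 'rV[R]_m).
Variables (f : 'rV[R]_m -> 'rV[R]_n.+1) (g : 'rV[R]_n.+1 -> 'rV[R]_m).
Variables (p : 'rV[R]_m -> 'rV[R]_k.+1) (q : 'rV[R]_k.+1 -> 'rV[R]_m).
Hypotheses (clA : closed A) (clD : closed D) (clE : closed E).
Hypotheses (scA : scale_invariant A) (scD : scale_invariant D).
Hypothesis fgA : cone_homeo A (@half_space R n) f g.
Hypothesis pqD : cone_homeo D (@half_space R k) p q.
(** [D] is the part of the boundary of [A] that carries the attached rays; [E] is a closed set that
    covers the rest of that boundary and meets [D] only at height 0. *)
Hypothesis DA : forall x, D x -> A x /\ vhead (f x) = 0.
Hypothesis DE : forall x, A x -> vhead (f x) = 0 -> D x \/ E x.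
Hypothesis DE0 : forall x, D x -> E x -> vhead (p x) = 0.

(* eta is the height of D extended by 0, foot y is the point of the boundary of
   A over y, and slide a x is x moved up by a inside D, with the height of D.
   The case distinctions in F and G only choose between formulas which agree where
   both make sense, see F0 and G2. *)
Let eta x := if `[< D x >] then vhead (p x) else 0.
Let foot (y : 'rV[R]_n) := g (vcons 0 y).
Let slide a x := q (vcons (vhead (p x) + a) (vtail (p x))).
Let X : set 'rV[R]_m.+1 :=
  [set x | [/\ 0 <= vhead x, A (vtail x) & vhead x <> 0 -> D (vtail x)]].
Let F x := if `[< D (vtail x) >]
  then vcons (vhead (p (vtail x))) (vtail (f (slide (vhead x) (vtail x))))
  else vcons (vhead (f (vtail x)) + eta (foot (vtail (f (vtail x)))))
         (vtail (f (vtail x))).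
Let G y := let e := eta (foot (vtail y)) in if e <= vhead y
  then vcons 0 (g (vcons (vhead y - e) (vtail y)))
  else vcons (e - vhead y) (q (vcons (vhead y) (vtail (p (foot (vtail y)))))).

Let etaD x : D x -> eta x = vhead (p x).
Proof. by move=> Dx; rewrite /eta asboolT. Qed.

Let etaE x : E x -> eta x = 0.
Proof. by move=> Ex; rewrite /eta; case: asboolP => // /DE0; apply. Qed.

Let eta_ge0 x : 0 <= eta x.
Proof.
rewrite /eta; case: asboolP => // Dx; have [_ _ pq _ _] := pqD.
exact: (pq _ Dx).1.
Qed.

Let footP y : [/\ A (foot y), vhead (f (foot y)) = 0 & vtail (f (foot y)) = y].
Proof.
have [_ _ _ gf _] := fgA; rewrite /foot.
have [|Ag ->] := gf (vcons 0 y); first by rewrite /half_space /= vhead_cons.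
by rewrite vhead_cons vconsK.
Qed.

Let foot_tail x : A x -> vhead (f x) = 0 -> foot (vtail (f x)) = x.
Proof.
have [_ _ fg _ _] := fgA.
by move=> Ax f0; rewrite /foot -f0 vcons_eta (fg _ Ax).2.
Qed.

Let slideP a x : 0 <= a -> D x ->
  D (slide a x) /\ p (slide a x) = vcons (vhead (p x) + a) (vtail (p x)).
Proof.
move=> a0 Dx; have [_ _ pq qp _] := pqD; apply: qp.
by rewrite /half_space /= vhead_cons addr_ge0 //; apply: (pq _ Dx).1.
Qed.

(** The shear sends the point with ray coordinate [a] over a point of [D] to depth [a] below the
    slid point. The shift by the height of the slid point, which is the original height plus [a],
    then leaves the original height. *)
Let FD x : D (vtail x) ->
  F x = vcons (vhead (p (vtail x))) (vtail (f (slide (vhead x) (vtail x)))).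
Proof. by move=> Dx; rewrite /F asboolT. Qed.

(** On [D] with ray coordinate 0 the slide does nothing and [f] has height 0, so both formulas give
    the height in [D]. *)
Let F0 x : A (vtail x) -> vhead x = 0 ->
  F x = vcons (vhead (f (vtail x)) + eta (foot (vtail (f (vtail x)))))
         (vtail (f (vtail x))).
Proof.
move=> Ax x0; rewrite /F; case: asboolP => // Dx.
have [_ f0] := DA Dx; have [_ _ pq _ _] := pqD.
by rewrite f0 foot_tail // etaD // add0r x0 /slide addr0 vcons_eta (pq _ Dx).2.
Qed.

Let G1 y : eta (foot (vtail y)) <= vhead y ->
  G y = vcons 0 (g (vcons (vhead y - eta (foot (vtail y))) (vtail y))).
Proof. by rewrite /G => ->. Qed.

(** On the graph of [eta] both formulas give the foot point with ray coordinate 0. *)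
Let G2 y : vhead y <= eta (foot (vtail y)) -> D (foot (vtail y)) ->
  G y = vcons (eta (foot (vtail y)) - vhead y)
          (q (vcons (vhead y) (vtail (p (foot (vtail y)))))).
Proof.
rewrite /G le_eqVlt => /orP[/eqP e Dz|]; last by rewrite ltNge => /negPf ->.
have [_ _ pq _ _] := pqD.
by rewrite -e lexx subrr e etaD // vcons_eta (pq _ Dz).2.
Qed.

Let foot_cont : {within setT, continuous foot}.
Proof.
have [_ cg _ _ _] := fgA; apply: within_continuous_trans cg _.
  by move=> y _; rewrite /half_space /= vhead_cons.
apply: within_continuous_vcons; last exact: within_continuous_id.
exact: within_continuous_cst.
Qed.

Let bd : set 'rV[R]_m := [set x | A x /\ vhead (f x) = 0].

(** The closed sets [D] and [E] cover the boundary of [A], and the formulas for [eta] on them agree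
    where they meet. *)
Let eta_cont : {within bd, continuous eta}.
Proof.
have [cp _ _ _ _] := pqD.
apply: (within_continuous_sub (B := D `|` E)).
  by move=> x [Ax f0]; apply: DE.
apply: withinU_continuous => //.
  apply: (within_continuous_ext (f := fun x => vhead (p x))).
    by move=> x Dx; rewrite etaD.
  exact: within_continuous_vhead.
apply: (within_continuous_ext (f := fun=> 0)); first by move=> x /etaE ->.
exact: within_continuous_cst.
Qed.

Let height_cont : {within setT, continuous (fun y => eta (foot y))}.
Proof.
apply: within_continuous_trans eta_cont foot_cont => y _.
by have [] := footP y.
Qed.

Let slide_cont : {within [set x | 0 <= vhead x /\ D (vtail x)],
  continuous (fun x => slide (vhead x) (vtail x))}.
Proof.
have [cp cq pq _ _] := pqD; set B := [set x | _].
have cpt : {within B, continuous (fun x => p (vtail x))}.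
  by apply: within_continuous_trans cp _ => [x []//|]; apply: within_vtail.
apply: within_continuous_trans cq _.
  move=> x [x0 Dx]; rewrite /half_space /= vhead_cons addr_ge0 //.
  exact: (pq _ Dx).1.
apply: within_continuous_vcons; last exact: within_continuous_vtail.
by apply: within_continuousD; [apply: within_continuous_vhead|apply: within_vhead].
Qed.

Let F_cont : {within X, continuous F}.
Proof.
have [cf _ _ _ _] := fgA; have [cp _ _ _ _] := pqD.
have cvt l : continuous (@vtail R l) by apply/continuousT/within_vtail.
have cvh l : continuous (@vhead R l) by apply/continuousT/within_vhead.
(* The ray coordinate is 0 on [X0], and [X1] lies over [D]; both are closed, and one formula for [F]
   is valid on each. *)
pose X0 := [set x : 'rV[R]_m.+1 | vhead x = 0 /\ A (vtail x)].
pose X1 := [set x : 'rV[R]_m.+1 | 0 <= vhead x /\ D (vtail x)].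
apply: (within_continuous_sub (B := X0 `|` X1)).
  move=> x [x0 Ax Dx]; have [e|/eqP e] := eqVneq (vhead x) 0; first by left.
  by right; split=> //; exact: Dx.
apply: withinU_continuous.
- apply: closedI; last by apply: closed_preimageT (cvt m) clA.
  exact: (closed_preimageT (C := [set a : R | a = 0]) (cvh m) (@closed_eq R 0)).
- apply: closedI; last by apply: closed_preimageT (cvt m) clD.
  exact: (closed_preimageT (C := [set a : R | 0 <= a]) (cvh m) (@closed_ge R 0)).
- have cft : {within X0, continuous (fun x => f (vtail x))}.
    by apply: within_continuous_trans cf _ => [x []//|]; apply: within_vtail.
  apply: within_continuous_ext => [x [x0 Ax]|]; first by rewrite F0.
  apply: within_continuous_vcons; last exact: within_continuous_vtail.
  apply: within_continuousD; first exact: within_continuous_vhead.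
  apply: within_continuous_trans height_cont _ => //.
  exact: within_continuous_vtail.
apply: within_continuous_ext => [x [x0 Dx]|]; first by rewrite FD.
apply: within_continuous_vcons.
  apply: within_continuous_vhead.
  by apply: within_continuous_trans cp _ => [x []//|]; apply: within_vtail.
apply: within_continuous_vtail.
apply: within_continuous_trans cf slide_cont => x [x0 Dx].
by have [/DA[]] := slideP x0 Dx.
Qed.

Let G_cont : {within @half_space R n, continuous G}.
Proof.
have [_ cg _ _ _] := fgA; have [cp cq _ _ _] := pqD.
have cft (B : set 'rV[R]_n.+1) : {within B, continuous (fun y => foot (vtail y))}.
  by apply: within_continuous_trans foot_cont _ => //; apply: within_vtail.
have ceta (B : set 'rV[R]_n.+1) :
    {within B, continuous (fun y => eta (foot (vtail y)))}.
  by apply: within_continuous_trans height_cont _ => //; apply: within_vtail.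
(* The two pieces lie above and below the graph of [eta]. They cover the half space because [eta] is
   0 on [E]: strictly under the graph at nonnegative height the foot point lies in [D]. *)
pose Y1 := [set y : 'rV[R]_n.+1 | 0 <= vhead y - eta (foot (vtail y))].
pose Y2 := [set y : 'rV[R]_n.+1 | (0 <= eta (foot (vtail y)) - vhead y /\
   0 <= vhead y) /\ D (foot (vtail y))].
have cle (u v : 'rV[R]_n.+1 -> R) : (forall B, {within B, continuous u}) ->
    (forall B, {within B, continuous v}) -> closed [set y | 0 <= u y - v y].
  move=> cu cv; apply: (closed_preimageT (f := fun y => u y - v y) (C := [set a : R | 0 <= a])).
    by apply/continuousT/within_continuousB.
  exact: closed_ge.
apply: (within_continuous_sub (B := Y1 `|` Y2)).
  move=> y y0; have [le|lt] := leP (eta (foot (vtail y))) (vhead y).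
    by left; rewrite /Y1 /= subr_ge0.
  right; split; first by rewrite subr_ge0 ltW.
  have [Az fz _] := footP (vtail y); case: (DE Az fz) => // Ez.
  by move: lt; rewrite etaE // ltNge y0.
apply: withinU_continuous.
- by apply: cle => // B; apply: within_vhead.
- apply: closedI; last by apply: closed_preimageT clD; apply: continuousT.
  apply: closedI; first by apply: cle => // B; apply: within_vhead.
  apply: (closed_preimageT (C := [set a : R | 0 <= a])); last exact: closed_ge.
  by apply/continuousT/within_vhead.
- apply: within_continuous_ext => [y y0|].
    by rewrite G1 // -subr_ge0.
  apply: within_continuous_vcons; first exact: within_continuous_cst.
  apply: within_continuous_trans cg _.
    by move=> y y0; rewrite /half_space /= vhead_cons.
  apply: within_continuous_vcons; last exact: within_vtail.
  by apply: within_continuousB => //; apply: within_vhead.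
apply: within_continuous_ext => [y [[y1 y0] Dy]|].
  by rewrite G2 // -subr_ge0.
apply: within_continuous_vcons.
  by apply: within_continuousB => //; apply: within_vhead.
apply: within_continuous_trans cq _.
  by move=> y [[y1 y0] Dy]; rewrite /half_space /= vhead_cons.
apply: within_continuous_vcons; first exact: within_vhead.
apply: within_continuous_vtail.
by apply: within_continuous_trans cp _ => [y []//|].
Qed.

Let D_or_E y : vhead y < eta (foot (vtail y)) -> 0 <= vhead y -> D (foot (vtail y)).
Proof.
have [Az fz _] := footP (vtail y); case: (DE Az fz) => // Ez.
by rewrite etaE // ltNge => /negPf ->.
Qed.

Let GF x : X x -> half_space (F x) /\ G (F x) = x.
Proof.
have [_ _ fg _ _] := fgA; have [_ _ pq _ _] := pqD.
move=> [x0 Ax Dx]; have [e|/eqP/Dx {}Dx] := eqVneq (vhead x) 0.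
  have f0 : 0 <= vhead (f (vtail x)) := (fg _ Ax).1.
  rewrite F0 // /half_space /= vhead_cons addr_ge0 ?eta_ge0 //; split=> //.
  rewrite G1 vconsK vhead_cons ?lerDr // addrK vcons_eta (fg _ Ax).2.
  by rewrite -[RHS]vcons_eta e.
(* The slid point has height [vhead (p (vtail x)) + vhead x] in [D], so subtracting the height of
   [F x] gives back the ray coordinate. *)
have [Ds ps] := slideP x0 Dx; have [_ fs] := DA Ds.
rewrite FD // /half_space /= vhead_cons; split; first exact: (pq _ Dx).1.
rewrite G2 !vconsK ?vhead_cons foot_tail ?etaD ?ps ?vhead_cons ?vconsK //.
- by rewrite addrAC subrr add0r vcons_eta (pq _ Dx).2 vcons_eta.
- by apply: (DA _).1.
- by rewrite lerDl.
- by apply: (DA _).1.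
by apply: (DA _).1.
Qed.

Let FG y : half_space y -> X (G y) /\ F (G y) = y.
Proof.
have [_ _ fg gf _] := fgA; have [_ _ pq qp _] := pqD.
rewrite /half_space /= => y0.
have [le|lt] := leP (eta (foot (vtail y))) (vhead y).
  have hs : half_space (vcons (vhead y - eta (foot (vtail y))) (vtail y)).
    by rewrite /half_space /= vhead_cons subr_ge0.
  have [Ag fgy] := gf _ hs.
  rewrite G1 // F0 ?vhead_cons ?vconsK //; split.
    by split; rewrite ?vhead_cons ?vconsK.
  by rewrite fgy !vhead_cons vconsK subrK vcons_eta.
have Dz := D_or_E lt y0.
have hs : half_space (vcons (vhead y) (vtail (p (foot (vtail y))))).
  by rewrite /half_space /= vhead_cons.
have [Dq pqy] := qp _ hs.
rewrite G2 ?ltW //; split.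
  split; rewrite ?vhead_cons ?vconsK //; first by rewrite subr_ge0 ltW.
  exact: (DA Dq).1.
rewrite FD ?vconsK // /slide pqy !vhead_cons vconsK addrC subrK etaD //.
rewrite vcons_eta (pq _ Dz).2; have [_ _ ->] := footP (vtail y).
exact: vcons_eta.
Qed.

Let FZ c x : 0 < c -> X x -> F (c *: x) = c *: F x.
Proof.
move=> cpos [x0 Ax Dx]; have [_ _ fg _ fZ] := fgA; have [_ _ pq _ pZ] := pqD.
have [e|/eqP/Dx {}Dx] := eqVneq (vhead x) 0.
  rewrite !F0 ?vheadZ ?vtailZ ?e ?mulr0 //; last exact: scA.
  rewrite fZ // vheadZ vtailZ -vconsZ mulrDr; congr (vcons (_ + _) _).
  (* [foot] and [p] are homogeneous and membership in [D] is invariant under scaling, hence [eta]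
     composed with [foot] is homogeneous. *)
  have -> z : foot (c *: z) = c *: foot z.
    rewrite /foot -[X in vcons X _](mulr0 c) vconsZ.
    by rewrite (cone_homeoVZ scA fgA) // /half_space /= vhead_cons.
  rewrite /eta; have sD := scale_invariantZ (foot (vtail (f (vtail x)))) scD cpos.
  case: asboolP => [/sD Dz|nDz]; first by rewrite asboolT // pZ // vheadZ.
  by rewrite asboolF ?mulr0 // => /sD.
rewrite !FD ?vtailZ //; last exact: scD.
rewrite pZ // vheadZ -vconsZ; congr vcons.
rewrite /slide vheadZ pZ // vheadZ vtailZ -mulrDr vconsZ.
have [Ds ps] := slideP x0 Dx.
rewrite (cone_homeoVZ scD pqD) //.
  by rewrite fZ ?vtailZ //; apply: (DA Ds).1.
by rewrite /half_space /= vhead_cons addr_ge0 //; apply: (pq _ Dx).1.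
Qed.

(** Over [D] the new height is the height in [D]. Elsewhere the ray coordinate is 0 and the new
    height is a sum of two nonnegative terms, the second of which vanishes on the boundary of [A]
    outside [D]. *)
Let F_height x : X x -> vhead (F x) = 0 <->
  (D (vtail x) /\ vhead (p (vtail x)) = 0) \/
  (~ D (vtail x) /\ vhead (f (vtail x)) = 0).
Proof.
move=> [x0 Ax Dx]; have [_ _ fg _ _] := fgA.
have [Dt|nDt] := pselect (D (vtail x)).
  by rewrite FD // vhead_cons; split=> [h|[[]|[]]] //; left.
have e : vhead x = 0 by apply: contrapT => /Dx.
rewrite F0 // vhead_cons; split=> [h|[[]|[_ f0]]] //; last first.
  rewrite f0 foot_tail // add0r; case: (DE Ax f0) => // Ex.
  exact: etaE.
right; split=> //; apply/eqP; rewrite eq_le (fg _ Ax).1 andbT -h lerDl.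
exact: eta_ge0.
Qed.

Lemma cone_homeo_glue_ball : exists F G,
  cone_homeo [set x | [/\ 0 <= vhead x, A (vtail x) & vhead x <> 0 -> D (vtail x)]]
    (@half_space R n) F G
  /\ forall x, 0 <= vhead x -> A (vtail x) -> (vhead x <> 0 -> D (vtail x)) ->
     vhead (F x) = 0 <-> (D (vtail x) /\ vhead (p (vtail x)) = 0) \/
       (~ D (vtail x) /\ vhead (f (vtail x)) = 0).
Proof.
exists F, G; split; last by move=> x x0 Ax Dx; apply: F_height.
split; [exact: F_cont|exact: G_cont|exact: GF|exact: FG|exact: FZ].
Qed.

End GlueBall.

(** * Normalizing cones to spheres and balls *)

Section Normalization.
Local Open Scope classical_set_scope.
Local Open Scope ring_scope.
Variable R : realType.

Lemma within_continuousZ (T : topologicalType) (A : set T) n (u : T -> R)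
    (f : T -> 'rV[R]_n) : {within A, continuous u} -> {within A, continuous f} ->
  {within A, continuous (fun x => u x *: f x)}.
Proof.
move=> cu cf; apply: within_continuous_rV => j.
apply: (within_continuous_ext (f := fun x => u x * f x 0 j)).
  by move=> x _; rewrite mxE.
by apply: within_continuousM => //; apply: within_continuous_coord.
Qed.

Lemma within_continuous_sqrt (T : topologicalType) (A : set T) (u : T -> R) :
  {within A, continuous u} -> {within A, continuous (fun x => Num.sqrt (u x))}.
Proof.
move=> cu; apply: (within_continuous_trans (B := setT) (g := Num.sqrt)) cu => //.
by apply: continuous_subspaceT => x; apply: sqrt_continuous.
Qed.

Lemma within_continuous_sqnorm (T : topologicalType) (A : set T) n
    (f : T -> 'rV[R]_n) : {within A, continuous f} ->
  {within A, continuous (fun x => sqnorm (f x))}.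
Proof.
move=> cf; apply: (within_continuous_sum (F := fun j x => f x 0 j ^+ 2)) => j.
apply: (within_continuous_ext (f := fun x => f x 0 j * f x 0 j)).
  by move=> x _; rewrite expr2.
by apply: within_continuousM; apply: within_continuous_coord.
Qed.

Lemma sqnorm_ge0 n (x : 'rV[R]_n) : 0 <= sqnorm x.
Proof. by apply: sumr_ge0 => i _; apply: sqr_ge0. Qed.

Lemma sqnorm_eq0 n (x : 'rV[R]_n) : (sqnorm x == 0) = (x == 0).
Proof.
apply/idP/eqP => [|->]; last by rewrite /sqnorm big1 // => i _; rewrite mxE expr0n.
rewrite psumr_eq0 => [/allP h|i _]; last exact: sqr_ge0.
apply/rowP => i; rewrite mxE; apply/eqP.
by have := h i; rewrite mem_index_enum sqrf_eq0 => /(_ isT).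
Qed.

Lemma sqnormZ n c (x : 'rV[R]_n) : sqnorm (c *: x) = c ^+ 2 * sqnorm x.
Proof. by rewrite /sqnorm mulr_sumr; apply: eq_bigr => i _; rewrite mxE exprMn. Qed.

Lemma sqnorm_vhead n (x : 'rV[R]_n.+1) :
  sqnorm x = vhead x ^+ 2 + sqnorm (vtail x).
Proof.
by rewrite /sqnorm big_ord_recl; congr (_ + _); apply: eq_bigr => i _; rewrite mxE.
Qed.

Definition coord_sum n (x : 'rV[R]_n) : R := \sum_i x 0 i.

Lemma coord_sumZ n c (x : 'rV[R]_n) : coord_sum (c *: x) = c * coord_sum x.
Proof. by rewrite /coord_sum mulr_sumr; apply: eq_bigr => i _; rewrite mxE. Qed.

Lemma coord_sum_gt0 n (x : 'rV[R]_n) : (forall i, 0 <= x 0 i) -> x <> 0 ->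
  0 < coord_sum x.
Proof.
move=> x0 xN0; rewrite lt0r sumr_ge0 // andbT; apply/negP.
rewrite psumr_eq0 // => /allP h; apply: xN0; apply/rowP => i; rewrite mxE.
by apply/eqP; have := h i; rewrite mem_index_enum => /(_ isT).
Qed.

Lemma within_continuous_coord_sum (T : topologicalType) (A : set T) n
    (f : T -> 'rV[R]_n) : {within A, continuous f} ->
  {within A, continuous (fun x => coord_sum (f x))}.
Proof.
move=> cf; apply: (within_continuous_sum (F := fun j x => f x 0 j)) => j.
exact: within_continuous_coord.
Qed.

Lemma homeomorphism_comp (T U V : topologicalType) (A : set T) (B : set U)
    (C : set V) f g :
  homeomorphism A B f -> homeomorphism B C g -> homeomorphism A C (fun x => g (f x)).
Proof.
move=> [f' [cf cf' ff' f'f]] [g' [cg cg' gg' g'g]].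
exists (fun z => f' (g' z)); split.
- by apply: within_continuous_trans cg cf => x /ff'[].
- by apply: within_continuous_trans cf' cg' => x /g'g[].
- by move=> x /ff'[Bfx ffx]; have [Cx ->] := gg' _ Bfx.
- by move=> z /g'g[Bz gz]; have [Ax ->] := f'f _ Bz.
Qed.

(** The zero vector is the only one fixed by doubling, and [f] is injective on [A] and commutes with
    doubling. *)
Lemma cone_homeo_eq0 m n (A : set 'rV[R]_m) (B : set 'rV[R]_n) f g x :
  cone_homeo A B f g -> scale_invariant A -> A x -> f x = 0 <-> x = 0.
Proof.
move=> [_ _ fg _ fZ] scA Ax; have two : 0 < 2 :> R by rewrite ltr0n.
have dbl l (y : 'rV[R]_l) : 2 *: y = y -> y = 0.
  by rewrite scaler_nat mulr2n => /eqP; rewrite -subr_eq0 addrK => /eqP.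
split=> e; apply: dbl; last by rewrite -fZ // e scaler0.
by rewrite -[RHS](fg _ Ax).2 -[LHS](fg _ (scA _ _ two Ax)).2 fZ // e scaler0.
Qed.

(** Every open ray from the origin meets the unit sphere once and, within the nonnegative vectors,
    the slice of coordinate sum 1 once. Homogeneous maps carry rays to rays, so rescaling turns them
    into maps between the slices. *)
Lemma cone_homeo_normalize m n (A : set 'rV[R]_m) (B : set 'rV[R]_n) f g :
  cone_homeo A B f g -> scale_invariant A -> scale_invariant B ->
  (forall x, A x -> forall i, 0 <= x 0 i) ->
  homeomorphism [set x | A x /\ coord_sum x = 1] (B `&` @unit_sphere R n)
    (fun x => (Num.sqrt (sqnorm (f x)))^-1 *: f x).
Proof.
move=> h scA scB A0; have [cf cg fg gf fZ] := h.
set A1 := [set x | _].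
have A1N0 x : A1 x -> x <> 0.
  move=> [_ s1] x0; have := oner_eq0 R; rewrite -s1 x0 /coord_sum big1 ?eqxx //.
  by move=> i _; rewrite mxE.
have Nf_gt0 x : A1 x -> 0 < Num.sqrt (sqnorm (f x)).
  move=> Ax; rewrite sqrtr_gt0 lt0r sqnorm_ge0 sqnorm_eq0 andbT; apply/eqP.
  by move/(cone_homeo_eq0 h scA Ax.1); apply: A1N0.
have sg_gt0 y : B y -> sqnorm y = 1 -> 0 < coord_sum (g y).
  move=> By y1; have [Ag fgy] := gf _ By; apply: coord_sum_gt0; first exact: A0.
  move/(cone_homeo_eq0 h scA Ag); rewrite fgy => /eqP; rewrite -sqnorm_eq0 y1.
  by rewrite oner_eq0.
exists (fun y => (coord_sum (g y))^-1 *: g y); split.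
- have cfA : {within A1, continuous f} by apply: within_continuous_sub cf => x [].
  apply: within_continuousZ => //; apply: within_continuousV.
    by move=> x /Nf_gt0; rewrite lt0r => /andP[].
  by apply: within_continuous_sqrt; apply: within_continuous_sqnorm.
- have cgB : {within B `&` @unit_sphere R n, continuous g}.
    by apply: within_continuous_sub cg => x [].
  apply: within_continuousZ => //; apply: within_continuousV.
    by move=> y [By /(sg_gt0 _ By)]; rewrite lt0r => /andP[].
  exact: within_continuous_coord_sum.
- move=> x Ax; have Np := Nf_gt0 x Ax; have [Bf gfx] := fg _ Ax.1.
  have Ni : 0 < (Num.sqrt (sqnorm (f x)))^-1 by rewrite invr_gt0.
  split; first split; first exact: scB.
    rewrite /unit_sphere /= sqnormZ exprVn sqr_sqrtr ?sqnorm_ge0 // mulVf //.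
    by move: Np; rewrite sqrtr_gt0 lt0r => /andP[].
  rewrite (cone_homeoVZ scA h) // gfx coord_sumZ Ax.2 mulr1 invrK scalerA.
  by rewrite mulfV ?scale1r // gt_eqF.
move=> y [By y1]; have sp := sg_gt0 _ By y1; have [Ag fgy] := gf _ By.
have si : 0 < (coord_sum (g y))^-1 by rewrite invr_gt0.
split; first by split; [exact: scA|rewrite coord_sumZ mulVf // gt_eqF].
rewrite fZ // fgy sqnormZ y1 mulr1 sqrtr_sqr gtr0_norm // invrK scalerA.
by rewrite mulfV ?scale1r // gt_eqF.
Qed.

(** The hemisphere is a graph over the ball: the forgotten height is recovered as a square root. *)
Lemma half_sphere_ball n :
  homeomorphism (@half_space R n `&` @unit_sphere R n.+1) (@unit_ball R n) (@vtail R n).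
Proof.
exists (fun y => vcons (Num.sqrt (1 - sqnorm y)) y); split.
- exact: within_vtail.
- apply: within_continuous_vcons; last exact: within_continuous_id.
  apply: within_continuous_sqrt; apply: within_continuousB.
    exact: within_continuous_cst.
  by apply: within_continuous_sqnorm; apply: within_continuous_id.
- move=> x [x0]; rewrite /unit_sphere /unit_ball /= sqnorm_vhead => x1.
  have -> : 1 - sqnorm (vtail x) = vhead x ^+ 2 by rewrite -x1 addrK.
  rewrite sqrtr_sqr ger0_norm // vcons_eta -x1 lerDr; split=> //.
  exact: sqr_ge0.
move=> y; rewrite /unit_ball /= => y1; split; last exact: vconsK.
split; first by rewrite /half_space /= vhead_cons sqrtr_ge0.
by rewrite /unit_sphere /= sqnorm_vhead vhead_cons vconsK sqr_sqrtr ?subrK // subr_ge0.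
Qed.

Lemma cone_homeo_sphere m n (A : set 'rV[R]_m) f g :
  cone_homeo A (@setT 'rV[R]_n) f g -> scale_invariant A ->
  (forall x, A x -> forall i, 0 <= x 0 i) ->
  exists F, homeomorphism [set x | A x /\ coord_sum x = 1] (@unit_sphere R n) F.
Proof.
move=> h scA A0; eexists; rewrite -[@unit_sphere R n]setTI.
exact: cone_homeo_normalize h scA _ A0.
Qed.

(** Rescaling does not affect whether the height is 0, and the projection of the hemisphere takes
    exactly the equator to the bounding sphere. *)
Lemma cone_homeo_ball m n (A : set 'rV[R]_m) f g :
  cone_homeo A (@half_space R n) f g -> scale_invariant A ->
  (forall x, A x -> forall i, 0 <= x 0 i) ->
  exists F, homeomorphism [set x | A x /\ coord_sum x = 1] (@unit_ball R n) F /\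
    F @` [set x | (A x /\ coord_sum x = 1) /\ vhead (f x) = 0] = @unit_sphere R n.
Proof.
move=> h scA A0; have [_ _ fg gf _] := h.
have scH : scale_invariant (@half_space R n).
  by move=> c x c0; rewrite /half_space /= vheadZ; apply: mulr_ge0; apply: ltW.
have hN := cone_homeo_normalize h scA scH A0.
have hF := homeomorphism_comp hN (half_sphere_ball n).
exists (fun x => vtail ((Num.sqrt (sqnorm (f x)))^-1 *: f x)); split=> //.
have [N' [_ _ N1 _]] := hN; have [G [_ _ FG GF]] := hF.
have key x : A x /\ coord_sum x = 1 ->
    sqnorm (vtail ((Num.sqrt (sqnorm (f x)))^-1 *: f x)) = 1 <-> vhead (f x) = 0.
  move=> Ax; have [[_]] := N1 _ Ax.
  rewrite /unit_sphere /= sqnorm_vhead => e _; set s := sqnorm (vtail _) in e *.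
  have -> : s = 1 - vhead ((Num.sqrt (sqnorm (f x)))^-1 *: f x) ^+ 2.
    by rewrite -e addrAC subrr add0r.
  rewrite vheadZ; split=> [/eqP|->]; last by rewrite mulr0 expr0n subr0.
  rewrite -subr_eq0 addrAC subrr sub0r oppr_eq0 sqrf_eq0 mulf_eq0 => /orP[|/eqP//].
  (* The scaling factor is not 0, since the rescaled vector has norm 1. *)
  move=> /eqP z; move: e; rewrite vheadZ /s z mul0r.
  by rewrite scale0r /sqnorm expr0n add0r big1 => [/esym/eqP|i _];
    rewrite ?oner_eq0 // !mxE expr0n.
rewrite predeqE => y; split=> [[x [Ax /(key _ Ax) e] <-]|y1] //.
have yb : @unit_ball R n y by rewrite /unit_ball /= y1.
have [AG FGy] := GF _ yb; exists (G y) => //; split=> //.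
by apply/(key _ AG); rewrite FGy.
Qed.

End Normalization.

(** * Cones over slide complexes *)

Section SlideCone.
Local Open Scope classical_set_scope.
Local Open Scope ring_scope.
Variables (R : realType) (T : eqType).
Implicit Types (Q S w : seq T) (c : T).

(** The support of a point is the face containing it in its interior, so the zero coordinates are
    the complement of that face. *)
Definition zero_set m (x : 'rV[R]_m) : {set 'I_m} := [set i | x 0 i == 0]%SET.
Definition zero_word Q (x : 'rV[R]_(size Q)) : seq T := word_at (zero_set x).
Definition nonneg m : set 'rV[R]_m := [set x | forall i, 0 <= x 0 i].
(** Its slice of coordinate sum 1 is the realization of the slide complex. *)
Definition slide_cone Q S : set 'rV[R]_(size Q) :=
  [set x | nonneg x /\ subseq S (zero_word x)].

Lemma word_at_cons c Q (P : {set 'I_(size Q).+1}) :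
  @word_at _ (c :: Q) P =
  let w := word_at [set i | lift ord0 i \in P]%SET in if ord0 \in P then c :: w else w.
Proof.
have enumE m (P' : {set 'I_m}) : enum P' = [seq i <- enum 'I_m | i \in P'].
  by rewrite {1}/enum_mem enumT.
rewrite /= /word_at !enumE enum_ordSl /= filter_map.
have -> : [seq i <- enum 'I_(size Q) | i \in [set i | lift ord0 i \in P]%SET] =
    [seq i <- enum 'I_(size Q) | preim (lift ord0) (mem P) i].
  by apply: eq_filter => i; rewrite inE.
have tE : tnth (in_tuple (c :: Q)) \o lift ord0 =1 tnth (in_tuple Q).
  by move=> i; rewrite /= !(tnth_nth c).
by case: ifP => _ /=; rewrite -map_comp (eq_map tE).
Qed.

Lemma zero_word_cons c Q (x : 'rV[R]_(size (c :: Q))) :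
  zero_word x = let w := zero_word (vtail x : 'rV_(size Q)) in
    if vhead x == 0 then c :: w else w.
Proof.
rewrite /zero_word word_at_cons inE /=.
have -> // : [set i | lift ord0 i \in zero_set x]%SET =
  zero_set (vtail x : 'rV_(size Q)) by apply/finset.setP => i; rewrite !inE mxE.
Qed.

Lemma zero_word_sub Q (x : 'rV[R]_(size Q)) : subseq (zero_word x) Q.
Proof.
have {2}-> : Q = word_at [set: 'I_(size Q)]%SET.
  by rewrite /word_at enum_setT -enumT map_tnth_enum.
by apply: word_at_mono; apply: finset.subsetT.
Qed.

Lemma nonneg_cons m (x : 'rV[R]_m.+1) :
  nonneg x <-> 0 <= vhead x /\ nonneg (vtail x).
Proof.
split=> [h|[h0 h] i]; first by split=> [|i]; rewrite ?mxE; apply: h.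
by case: (unliftP ord0 i) => [j|] -> //; have := h j; rewrite mxE.
Qed.

Lemma zero_wordZ Q a (x : 'rV[R]_(size Q)) : 0 < a ->
  zero_word (a *: x) = zero_word x.
Proof.
move=> a0; congr word_at; apply/finset.setP => i.
by rewrite !inE mxE mulf_eq0 gt_eqF.
Qed.

Lemma nonnegZ m a (x : 'rV[R]_m) : 0 < a -> nonneg x -> nonneg (a *: x).
Proof. by move=> a0 h i; rewrite mxE; apply: mulr_ge0; [apply: ltW|apply: h]. Qed.

Lemma slide_cone_scale Q S : scale_invariant (@slide_cone Q S).
Proof.
by move=> a x a0 [x0 Sx]; split; [apply: nonnegZ|rewrite zero_wordZ].
Qed.

(** As [p] passes to larger words, [p (zero_word x)] says that [x] vanishes on some [P] with
    [p (word_at P)]; this gives a finite union of closed sets. *)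
Lemma closed_zero_word Q (p : seq T -> Prop) :
  (forall u w, subseq u w -> p u -> p w) ->
  closed [set x : 'rV[R]_(size Q) | nonneg x /\ p (zero_word x)].
Proof.
move=> pm; have ->: [set x : 'rV[R]_(size Q) | nonneg x /\ p (zero_word x)] =
    \bigcap_(i in setT) [set x | 0 <= x 0 i] `&`
    \bigcup_(P in [set P : {set 'I_(size Q)} | p (word_at P)])
      \bigcap_(i in [set i | i \in P]) [set x | x 0 i = 0].
  rewrite predeqE => x; split=> [[x0 px]|[x0 [P pP xP]]]; split.
  - by move=> i _; apply: x0.
  - by exists (zero_set x) => // i /=; rewrite inE => /eqP.
  - by move=> i; apply: x0.
  apply: (pm (word_at P)) => //; apply: word_at_mono; apply/fintype.subsetP => i iP.
  by rewrite inE; apply/eqP; apply: xP.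
have cc m (i : 'I_m) : continuous (fun x : 'rV[R]_m => x 0 i).
  by move=> x; apply: coord_continuous.
apply: closedI.
  apply: closed_bigI => i _.
  exact: (closed_preimageT (C := [set a : R | 0 <= a]) (cc _ i) (@closed_ge R 0)).
apply: closed_bigcup => [|P _]; first exact: finite_finset.
apply: closed_bigI => i _.
exact: (closed_preimageT (C := [set a : R | a = 0]) (cc _ i) (@closed_eq R 0)).
Qed.

Lemma closed_slide_cone Q S : closed (@slide_cone Q S).
Proof.
apply: (closed_zero_word (p := fun w => subseq S w)) => u w uw Su.
exact: subseq_trans Su uw.
Qed.

Lemma slide_cone_cons_neq c Q S : ohead S != Some c ->
  @slide_cone (c :: Q) S = join_ray (@slide_cone Q S).
Proof.
move=> hS; rewrite predeqE => x; rewrite /slide_cone /join_ray /= zero_word_cons.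
rewrite -and_assoc -nonneg_cons /=.
by case: ifP => _; rewrite ?subseq_cons_neq.
Qed.

(** When the first coordinate is 0, the letter [c] is available and the rest need only contain [S];
    otherwise the rest must contain [c :: S], and with it [S]. *)
Lemma slide_cone_cons c Q S :
  @slide_cone (c :: Q) (c :: S) = [set x | [/\ 0 <= vhead x,
    @slide_cone Q S (vtail x) & vhead x <> 0 -> @slide_cone Q (c :: S) (vtail x)]].
Proof.
rewrite predeqE => x; split.
  move=> [/nonneg_cons[x0 xt]]; rewrite zero_word_cons /=.
  case: eqP => [xz|xz] Sx; first by split=> //; split=> //; rewrite /= eqxx in Sx.
  by split=> //; split=> //; apply: subseq_behead Sx.
move=> [x0 [xt Sx] h]; split; first exact/nonneg_cons.
rewrite zero_word_cons /=; case: eqP => [_|/h[]//].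
by rewrite /= eqxx.
Qed.

Lemma slide_cone_nsub c Q S : ~~ subseq (c :: S) Q ->
  @slide_cone (c :: Q) (c :: S) =
  [set x | vhead x = 0 /\ @slide_cone Q S (vtail x)].
Proof.
move=> nS; rewrite slide_cone_cons predeqE => x; split=> [[x0 Ax Dx]|[x0 Ax]].
  split=> //; apply: contrapT => /Dx[_ Sw].
  by move: nS; rewrite (subseq_trans Sw (zero_word_sub _)).
by split; rewrite ?x0.
Qed.

(** The description of the points of height 0 is carried through the induction because it locates
    the set along which the next rays are attached. *)
Lemma slide_cone_homeo Q S : delta S = S -> subseq S Q ->
  (delta Q = S -> exists n f g, cone_homeo (@slide_cone Q S) (@setT 'rV[R]_n) f g) /\
  (delta Q <> S -> exists n f g, cone_homeo (@slide_cone Q S) (@half_space R n) f g /\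
     forall x, slide_cone S x -> vhead (f x) = 0 <-> delta (zero_word x) <> S).
Proof.
elim: Q S => [|c Q IH] S hS.
  rewrite subseq0 => /eqP ->; split=> // _; exists 0, id, id.
  split=> //; do ?exact: within_continuous_id.
  by move=> x _; split=> //; split=> [[]|] //; apply: sub0seq.
have [cS|cS] := boolP (ohead S == Some c); last first.
  rewrite subseq_cons_neq // => SQ; split=> [|_].
    by move/delta_cons_neq: cS => /(_ Q).
  rewrite slide_cone_cons_neq //; have [IHs IHb] := IH _ hS SQ.
  have [dQ|dQ] := pselect (delta Q = S).
    have [n [f [g h]]] := IHs dQ.
    exists n; do 2!eexists; split; first exact: cone_homeo_join_sphere h.
    (* Every word between [S] and [Q] collapses to [S], so the ray coordinate alone decides whether
       the point is on the boundary. *)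
    move=> x [_ [_ Sx]]; rewrite /= vhead_cons zero_word_cons /=.
    split=> [->|]; first by rewrite eqxx; apply: delta_cons_neq.
    case: eqP => // _ []; apply: contrapT => ne.
    exact: (delta_neq_mono hS Sx (zero_word_sub _) ne).
  have [n [f [g [h hz]]]] := IHb dQ; have [_ _ fg _ _] := h.
  exists n.+1; do 2!eexists; split; first exact: cone_homeo_join_ball h.
  move=> x [x0 Ax]; have f0 : 0 <= vhead (f (vtail x)) := (fg _ Ax).1.
  rewrite /= vhead_cons zero_word_cons /=; case: eqP => [->|/eqP xN0].
    by rewrite min_r //; split=> // _; apply: delta_cons_neq.
  rewrite -hz // minEle; case: ifPn => // /negbTE lt.
  split=> [e|e]; first by rewrite e eqxx in xN0.
  by rewrite e x0 in lt.
case: S hS cS => // d S hS /eqP[dc]; subst d; rewrite [subseq _ _]/= eqxx => SQ.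
have hS' : delta S = S by case/delta_id_cons: hS.
have [IHs IHb] := IH _ hS' SQ.
have [cSQ|nSQ] := boolP (subseq (c :: S) Q); last first.
  rewrite slide_cone_nsub // (propext (delta_cons_nsub hS nSQ)).
  split=> [/IHs[n [f [g h]]]|/IHb[n [f [g [h hz]]]]].
    by exists n; do 2!eexists; apply: cone_homeo_zero h.
  exists n; do 2!eexists; split; first exact: cone_homeo_zero h.
  move=> x [x0 Ax]; rewrite hz // zero_word_cons /= x0 eqxx delta_cons_nsub //.
  by apply: contra nSQ => h1; apply: subseq_trans h1 (zero_word_sub _).
have nsub w : subseq (c :: S) w -> delta w <> S.
  by move=> /(sub_delta hS) sw e; have := size_subseq sw; rewrite e ltnn.
(* [Q] contains the longer word [c :: S], so [delta Q] is not [S] and the cone for [S] is a half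
   space. *)
have [n [f [g [h hz]]]] := IHb (nsub _ cSQ).
have [JHs JHb] := IH _ hS cSQ.
rewrite (propext (delta_cons_sub hS cSQ)).
have DA x : slide_cone (c :: S) x -> slide_cone S x /\ vhead (f x) = 0.
  move=> [x0 Sx]; have Ax : slide_cone S x by split=> //; apply: subseq_behead Sx.
  by split=> //; apply/hz => //; apply: nsub.
rewrite slide_cone_cons; split=> dQ.
  exists n.+1; do 2!eexists.
  (* Here the rays are attached along the whole boundary: a collapse longer than [S] inside [c :: S]
     is [c :: S]. *)
  have -> : [set x | [/\ 0 <= vhead x, @slide_cone Q S (vtail x)
      & vhead x <> 0 -> @slide_cone Q (c :: S) (vtail x)]] =
    [set x : 'rV[R]_(size Q).+1 | [/\ 0 <= vhead x, slide_cone S (vtail x)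
      & vhead x <> 0 -> vhead (f (vtail x)) = 0]].
    rewrite predeqE => x; split=> -[x0 Ax h0]; split=> // /h0; first by case/DA.
    move=> /(hz _ Ax) ne; have [xt Sx] := Ax; split=> //.
    pose w := zero_word (vtail x : 'rV_(size Q)).
    have lt := size_delta_gt hS' Sx ne.
    have ds : subseq (delta w) (c :: S) by rewrite -dQ delta_mono ?zero_word_sub.
    have <- : delta w = c :: S; last exact: delta_sub.
    by apply/eqP; rewrite -(size_subseq_leqif ds) eqn_leq size_subseq.
  exact: cone_homeo_glue_sphere h.
have [k [p [q [hp pz]]]] := JHb dQ.
(* [E] collects the boundary points whose word collapses to neither [S] nor [c :: S]; those in the
   cone for [c :: S] lie on the boundary of that cone. *)
pose E := [set x : 'rV[R]_(size Q) | nonneg x /\ [/\ subseq S (zero_word x),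
  delta (zero_word x) <> S & delta (zero_word x) <> c :: S]].
have clE : closed E.
  apply: (closed_zero_word (p := fun w =>
    [/\ subseq S w, delta w <> S & delta w <> c :: S])).
  move=> u w uw [Su ne1 ne2]; split.
  - exact: subseq_trans Su uw.
  - exact: delta_neq_mono hS' Su uw ne1.
  - exact: delta_neq_behead hS Su uw ne1 ne2.
have DE x : slide_cone S x -> vhead (f x) = 0 -> slide_cone (c :: S) x \/ E x.
  move=> Ax /(hz _ Ax) ne; have [x0 Sx] := Ax.
  have [e|ne'] := pselect (delta (zero_word x) = c :: S); last by right.
  by left; split=> //; rewrite -e delta_sub.
have DE0 x : slide_cone (c :: S) x -> E x -> vhead (p x) = 0.
  by move=> Dx [_ [_ _ ne]]; apply/pz.
have [F [G [hFG Fz]]] := cone_homeo_glue_ball (@closed_slide_cone Q S)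
  (@closed_slide_cone Q (c :: S)) clE (@slide_cone_scale Q S)
  (@slide_cone_scale Q (c :: S)) h hp DA DE DE0.
exists n, F, G; split=> // x [x0 Ax Dx]; rewrite Fz // zero_word_cons /=.
have [Dt|nDt] := pselect (slide_cone (c :: S) (vtail x : 'rV_(size Q))).
  have [_ Sx] := Dt; rewrite pz //.
  have e : delta (if vhead x == 0 then c :: zero_word (vtail x : 'rV_(size Q)) else
      zero_word (vtail x : 'rV_(size Q))) = c :: S <->
      delta (zero_word (vtail x : 'rV_(size Q))) = c :: S.
    by case: ifP => // _; apply: delta_cons_sub.
  by rewrite e; split=> [[[]|[]]|]; [| |left].
have xz : vhead x = 0 by apply: contrapT => /Dx.
rewrite xz eqxx hz // delta_cons_nsub //; last first.
  by apply/negP => Sx; apply: nDt; split=> //; apply: Ax.1.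
by split=> [[[]|[]]|]; [| |right].
Qed.

End SlideCone.

(** * From cones to realizations *)

Theorem theorem4p5 (R : realType) (Pi : groupType) (Sigma : {pred Pi})
    (Q S : seq Pi) (hcox : coxeter_system Sigma)
    (hQ : {subset Q <= Sigma}) (hS : {subset S <= Sigma})
    (hdS : delta S = S) :
  [/\ delta Q = S -> sphere_complex R (slide_complex Q S),
      delta Q <> S -> subseq S Q -> ball_complex R (slide_complex Q S)
    & forall P : {set 'I_(size Q)}, (~: P)%SET \in slide_complex Q S ->
        ((~: P)%SET \in boundary_complex (slide_complex Q S)
         <-> delta (word_at P) <> S)].
Proof.
have supp m (x : 'rV[R]_m) : [set i | x 0%R i != 0%R]%SET = (~: zero_set x)%SET.
  by apply/finset.setP => i; rewrite !inE.
have realE : realization (slide_complex Q S) =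
    [set x : 'rV[R]_(size Q) | slide_cone S x /\ coord_sum x = 1%R]%classic.
  rewrite predeqE => x; rewrite /realization /= supp inE finset.setCK.
  by split=> [[x0 x1 Sx]|[[x0 Sx] x1]].
have nn (x : 'rV[R]_(size Q)) : slide_cone S x -> forall i, (0 <= x 0%R i)%R.
  by case.
have sc := @slide_cone_scale R _ Q S.
split; last exact: slide_boundaryP.
  move=> dQ; have SQ : subseq S Q by rewrite -dQ delta_sub.
  have [n [f [g h]]] := (slide_cone_homeo R hdS SQ).1 dQ.
  by have [F hF] := cone_homeo_sphere h sc nn; exists n, F; rewrite realE.
move=> dQ SQ; have [n [f [g [h hz]]]] := (slide_cone_homeo R hdS SQ).2 dQ.
have [F [hF Fb]] := cone_homeo_ball h sc nn; exists n, F; split; first by rewrite realE.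
(* Both sets consist of the points whose zero word does not collapse to [S]: one by the description
   of the boundary faces, the other by that of the points of height 0. *)
rewrite -Fb; congr image; rewrite predeqE => x; rewrite /realization /= supp.
split=> [[x0 x1 xb]|[[Ax x1] fx]].
  have xK : (~: zero_set x)%SET \in slide_complex Q S.
    by move: xb; rewrite inE => /andP[].
  have Ax : slide_cone S x by split=> //; rewrite inE finset.setCK in xK.
  by split=> //; apply/hz => //; apply/(slide_boundaryP hdS).
split=> //; first exact: nn.
apply/(slide_boundaryP hdS); first by rewrite inE finset.setCK; case: Ax.
exact/hz.
Qed.
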